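(* For any $\epsilon\in(0,\frac12)$ and any $n=\Omega(1/\epsilon^2)$, there exists an unweighted $n$-vertex planar graph $G=(V,E)$ of diameter $D\le 1/\epsilon+2$ such that for every deterministic dominating embedding $f:V(G)\to V(H)$ into a graph $H$ with additive distortion $+\epsilon D$ (i.e., $d_G(u,v)\le d_H(f(u),f(v))\le d_G(u,v)+\epsilon D$ for all $u,v\in V$), the treewidth of $H$ is $\Omega(1/\epsilon)$.
   Context: $d_G$, $d_H$ denote shortest-path distances; $H$ may be edge-weighted. *)

(* Defs.v *)
From HB Require Import structures.
From mathcomp Require Import all_boot all_order all_algebra.
From mathcomp Require Import all_classical all_reals all_analysis.
Set Implicit Arguments.
Unset Strict Implicit.
Unset Printing Implicit Defensive.
Import Order.TTheory GRing.Theory Num.Theory numFieldNormedType.Exports.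
Local Open Scope classical_set_scope.
Local Open Scope ring_scope.

Record sgraph := SGraph {
  vertex :> finType;
  adj : rel vertex;
  adj_sym : symmetric adj;
  adj_irrefl : irreflexive adj }.

(* The edges of [G] carry the weights [w x y]; values of [w] on non-adjacent
   pairs are never used. *)
Definition edge_weighting (R : realType) (G : sgraph) (w : G -> G -> R) : Prop :=
  forall x y : G, adj x y -> 0 <= w x y /\ w x y = w y x.

Definition unit_weight (R : realType) (G : sgraph) : G -> G -> R :=
  fun _ _ => 1.

(* The path runs through the vertices [x :: p]. *)
Definition path_from_to (G : sgraph) (x y : G) (p : seq G) : Prop :=
  [/\ path (@adj G) x p, uniq (x :: p) & last x p = y].

Definition path_weight (R : realType) (G : sgraph) (w : G -> G -> R)
    (x : G) (p : seq G) : R :=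
  \sum_(a <- pairmap w x p) a.

(* Shortest-path distance; it is [+oo] between distinct components. *)
Definition wdist (R : realType) (G : sgraph) (w : G -> G -> R) (x y : G) :
    \bar R :=
  ereal_inf [set (path_weight w x p)%:E | p in path_from_to x y].

Definition gdist (R : realType) (G : sgraph) (x y : G) : \bar R :=
  wdist (@unit_weight R G) x y.

Definition diameter (R : realType) (G : sgraph) : \bar R :=
  ereal_sup [set d | exists x y : G, d = gdist R x y].

Definition is_arc (R : realType) (A : set (R * R)) (a b : R * R) : Prop :=
  exists g : R -> R * R,
    [/\ {within `[0, 1], continuous g},
        {in `[0, 1] &, injective g},
        g 0 = a, g 1 = b & A = g @` `[0, 1]].

(* [A x y] is the arc representing the edge [xy]; its interior contains no
   vertex and no point of an arc representing another edge. *)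
Definition plane_drawing (R : realType) (G : sgraph) (pt : G -> R * R)
    (A : G -> G -> set (R * R)) : Prop :=
  injective pt /\
  forall x y : G, adj x y ->
    [/\ is_arc (A x y) (pt x) (pt y),
        A x y = A y x &
        forall q : R * R, A x y q -> q <> pt x -> q <> pt y ->
          (forall z : G, q <> pt z) /\
          (forall z t : G, adj z t -> [set z; t]%SET != [set x; y]%SET ->
             ~ A z t q)].

Definition planar (R : realType) (G : sgraph) : Prop :=
  exists (pt : G -> R * R) (A : G -> G -> set (R * R)), plane_drawing pt A.

Definition is_tree (T : sgraph) : Prop :=
  [/\ (0 < #|T|)%N,
      forall s t : T, connect (@adj T) s t &
      forall c : seq T, (2 < size c)%N -> uniq c -> ~~ cycle (@adj T) c].

Definition tree_decomposition (G T : sgraph) (B : T -> {set G}) : Prop :=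
  [/\ is_tree T,
      forall x : G, exists t : T, x \in B t,
      forall x y : G, adj x y -> exists t : T, (x \in B t) && (y \in B t) &
      forall (x : G) (s t : T), x \in B s -> x \in B t ->
        connect [rel a b | [&& adj a b, x \in B a & x \in B b]] s t].

(* For the graph without vertices, the value is 0 instead of -1. *)
Definition width (G T : sgraph) (B : T -> {set G}) : nat :=
  (\max_(t : T) #|B t|).-1.

Definition has_width (G : sgraph) (k : nat) : bool :=
  `[< exists (T : sgraph) (B : T -> {set G}),
        tree_decomposition B /\ width B = k >].

Lemma has_width_exists (G : sgraph) : exists k, has_width G k.
Proof.
pose T := @SGraph unit (fun _ _ => false) (fun _ _ => erefl) (fun _ => erefl).
pose B : T -> {set G} := fun _ => [set: G]%SET.
exists (width B); apply/asboolP; exists T, B; split=> //; split.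
- split=> [|[] []|[|[] [|[] c]] //=]; [by rewrite card_unit | exact: connect0].
- by move=> x; exists tt; rewrite inE.
- by move=> x y _; exists tt; rewrite !inE.
- by move=> x [] [] _ _; exact: connect0.
Qed.

Definition treewidth (G : sgraph) : nat := ex_minn (has_width_exists G).

(* Main.v *)
Require Import Defs.
From HB Require Import structures.
From mathcomp Require Import all_boot all_order all_algebra.
From mathcomp Require Import all_classical all_reals all_analysis.
From mathcomp Require Import zify ring lra.
Set Implicit Arguments.
Unset Strict Implicit.
Unset Printing Implicit Defensive.
Import Order.TTheory GRing.Theory Num.Theory numFieldNormedType.Exports.
Local Open Scope classical_set_scope.
Local Open Scope ring_scope.

(* [G] is a k x k grid, with k about 1/(2 eps), plus leaves at the corner (0,0)
   that bring the number of vertices to n. Since eps D <= 1 + 2 eps < 2, adjacent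
   vertices of [G] have images at distance < 3 in [H]. Around the image of each
   vertex take the open ball of radius 3/2; the union of the balls of a connected
   set of [G] is connected in [H]. The crosses (a row and a column) thus give
   connected, pairwise intersecting sets of [H], a bramble. As the embedding is
   dominating, a vertex of [H] meets the balls of at most 3 rows and 3 columns, so
   a set of fewer than k/3 vertices misses a whole cross. By the Helly property of
   subtrees some bag meets every cross, hence has at least k/3 vertices. *)

(** * Unique paths and the Helly property in trees *)

(** Once common initial vertices are stripped, the two paths leave [x] through different vertices.
    Following the first one up to the first vertex [z] that lies on the second, then returning along
    the second, closes a cycle; it has length at least 3 because the two first vertices differ. *)
Lemma acyclic_path_unique (T : sgraph) (x : T) (p q : seq T) :
  (forall c : seq T, (2 < size c)%N -> uniq c -> ~~ cycle (@adj T) c) ->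
  path (@adj T) x p -> uniq (x :: p) -> path (@adj T) x q -> uniq (x :: q) ->
  last x p = last x q -> p = q.
Proof.
move=> acT; elim: p q x => [|a p IHp] [|b q] x //.
- by move=> _ _ _ /= /andP[+ _] xE; rewrite {1}xE mem_last.
- by move=> _ /= /andP[+ _] _ _ xE; rewrite -{1}xE mem_last.
move=> pxp uxp pxq uxq lastE.
have [eab|neab] := eqVneq a b.
  move: pxp uxp pxq uxq lastE; rewrite -eab /=.
  move=> /andP[_ pap] /andP[_ uap] /andP[_ paq] /andP[_ uaq] lastE.
  by rewrite (IHp q a).
exfalso.
have meet : has (mem (b :: q)) (a :: p).
  have lastE' : last a p = last b q by [].
  by apply/hasP; exists (last b q); [rewrite -lastE' mem_last | exact: mem_last].
have headE : head x (a :: p) != head x (b :: q) by [].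
move: (a :: p) (b :: q) meet headE pxp uxp pxq uxq => {neab lastE IHp} P Q.
case/split_find=> z p1 p2 zQ p1Q; case/splitPr: zQ p1Q => q1 q2 p1Q.
rewrite -!cat_cons -!cat_rcons !cat_path !cat_uniq.
move=> headE /andP[pxp1 _] /and3P[uxp1 _ _] /andP[pxq1 _] /and3P[uxq1 _ _].
have q1z : path (@adj T) z (rcons (rev q1) x).
  have := rev_path (@adj T) x (rcons q1 z).
  rewrite last_rcons belast_rcons rev_cons => ->.
  by rewrite (eq_path (e' := @adj T)) // => u v; rewrite adj_sym.
apply: (negP (acT (x :: rcons p1 z ++ rev q1) _ _)).
- rewrite /= size_cat size_rcons size_rev ltnS.
  by case: p1 q1 headE {p1Q pxp1 uxp1 pxq1 uxq1 q1z} => [|? ?] [|? ?] //=; rewrite eqxx.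
- rewrite -cat_cons cat_uniq uxp1 rev_uniq /=.
  move: (uxq1 : uniq (rcons (x :: q1) z)); rewrite rcons_uniq => /andP[zq1 /= /andP[xq1 ->]].
  rewrite andbT; apply/hasPn => y; rewrite mem_rev => yq1 /=.
  rewrite inE mem_rcons inE !negb_or; apply/and3P; split.
  + by apply: contraNneq xq1 => <-.
  + by apply: contraNneq zq1 => <-; rewrite inE yq1 orbT.
  + by apply: contra p1Q => yp1; apply/hasP; exists y => //=; rewrite mem_cat yq1.
- by rewrite /= rcons_cat cat_path pxp1 last_rcons.
Qed.

Definition induced_adj (T : sgraph) (U : {set T}) : rel T :=
  [rel a b | [&& adj a b, a \in U & b \in U]].

Definition connected_in (T : sgraph) (U : {set T}) : Prop :=
  forall a b, a \in U -> b \in U -> connect (induced_adj U) a b.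

Lemma induced_connect_sym (T : sgraph) (U : {set T}) :
  connect_sym (induced_adj U).
Proof.
by apply: sym_connect_sym => a b; rewrite /induced_adj /= adj_sym [(a \in U) && _]andbC.
Qed.

Lemma connect_ind (T : finType) (e : rel T) (P : T -> Prop) (a b : T) :
  (forall x y, e x y -> P x -> P y) -> connect e a b -> P a -> P b.
Proof.
move=> step /connectP[p pp ->] {b}; elim: p a pp => //= y p IHp a /andP[ay yp] Pa.
exact: IHp yp (step _ _ ay Pa).
Qed.

(* Root the tree at [r], and let [p s] be the path from [r] to [s]. Each subtree
   lies below its vertex nearest to [r]; the deepest of these top vertices belongs
   to all the subtrees. *)
Lemma tree_helly (T : sgraph) (I : finType) (S : I -> {set T}) (i0 : I) :
  is_tree T -> (forall i, connected_in (S i)) ->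
  (forall i j, exists t, (t \in S i) && (t \in S j)) ->
  exists t, forall i, t \in S i.
Proof.
move=> [/card_gt0P[r _] conn acT] Sconn meet.
have /fin_all_exists[p pP] s : exists p, path_from_to r s p.
  have /connectP[q /shortenP[q' q'p q'u _] ->] := conn r s.
  by exists q'.
have p_uniq s q : path (@adj T) r q -> uniq (r :: q) -> last r q = s -> p s = q.
  by move=> qp qu <-; have [pp pu pl] := pP (last r q); apply: (@acyclic_path_unique _ r).
(* Either [t] is off the root path of [s], and appending it gives the root path of [t]; or the piece
   of that path from [t] to [s] must, by uniqueness, be the single edge. *)
have p_adj s t : adj s t -> p t = rcons (p s) t \/ p s = rcons (p t) s.
  move=> st; have [psp psu psl] := pP s.
  have [tps|tps] := boolP (t \in r :: p s); last first.
    left; apply: p_uniq; rewrite ?last_rcons ?rcons_path ?psp ?psl //.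
    by rewrite -rcons_cons rcons_uniq tps.
  right; have [q Es] : exists q, p s = q by exists (p s).
  rewrite Es; rewrite Es in tps psp psu psl.
  case/splitPl: tps psp psu psl {Es} => p1 p2 p1t.
  rewrite cat_path last_cat -cat_cons cat_uniq p1t => /andP[p1p p2p] /and3P[p1u p12 p2u] psl.
  rewrite (p_uniq t p1) // -cats1; congr (_ ++ _).
  apply: (@acyclic_path_unique _ t) => //=.
  - rewrite p2u andbT; apply: contra p12 => tp2; apply/hasP; exists t => //=.
    by rewrite -p1t mem_last.
  - by rewrite adj_sym st.
  - by rewrite inE andbT; apply: contraTneq st => ->; rewrite adj_irrefl.
have p_last s : last r (p s) = s by have [] := pP s.
have p_self s : s \in r :: p s by rewrite -{1}(p_last s) mem_last.
have p_deepest s a : a \in r :: p s -> (size (p s) <= size (p a))%N -> a = s.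
  move=> aps; have [psp psu psl] := pP s; move: psp psu psl.
  case/splitPl: aps => p1 p2 p1a.
  rewrite cat_path last_cat -cat_cons cat_uniq size_cat p1a.
  move=> /andP[p1p _] /and3P[p1u _ _] psl; rewrite (p_uniq a p1) //.
  by case: p2 psl => //= ? ? _; lia.
have /fin_all_exists[top topP] i : exists m, m \in S i /\ forall s, s \in S i ->
    m \in r :: p s /\ forall a, a \in r :: p s -> (size (p m) <= size (p a))%N -> a \in S i.
  (* The diagonal case of [meet] says that [S i] is nonempty. *)
  have [s0 /andP[s0S _]] := meet i i.
  case: (arg_minnP (fun s => size (p s)) s0S) => m mS m_min; exists m; split=> // s sS.
  (* The invariant travels from [m] along the edges inside [S i]. A step away from the root appends
     a vertex of [S i] to the root path. A step towards the root drops the last vertex, which is not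
     [m]: otherwise [y] would be a vertex of [S i] nearer to the root than [m]. *)
  apply: (connect_ind (P := fun s => m \in r :: p s /\ forall a, a \in r :: p s ->
    (size (p m) <= size (p a))%N -> a \in S i) _ (Sconn i m s mS sS)); last first.
    by split=> // a amp /(p_deepest _ _ amp) ->.
  move=> x y /and3P[xy xS yS] [mx Sx]; have [E|E] := p_adj x y xy.
    rewrite E -rcons_cons mem_rcons inE mx orbT; split=> // a.
    by rewrite mem_rcons inE => /orP[/eqP-> //|]; exact: Sx.
  have Ex : r :: p x = rcons (r :: p y) x by rewrite E.
  split=> [|a ay]; last by apply: Sx; rewrite Ex mem_rcons inE ay orbT.
  move: mx; rewrite Ex mem_rcons inE => /orP[/eqP mx|//].
  by have := m_min y yS; rewrite mx E size_rcons ltnn.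
(* For [s] common to [S i] and [S j], the vertex [top i] is on the root path of [s] and at least as
   deep as [top j], so the property of [top j] puts it in [S j]. *)
case: (@arg_maxnP _ i0 xpredT (fun i => size (p (top i)))) => // i _ i_max.
exists (top i) => j; have [s /andP[si sj]] := meet i j.
have [_ /(_ s si)[tops _]] := topP i.
by have [_ /(_ s sj)[_]] := topP j; apply => //; exact: i_max.
Qed.

(** * Brambles and lower bounds on treewidth *)

(** The tree nodes whose bags meet [S i] form a connected set, because adjacent vertices of [S i]
    share a bag. Any bag containing a common vertex of [S i] and [S j] is a common node of their two
    sets, so [tree_helly] applies. *)
Lemma bramble_bag (H T : sgraph) (B : T -> {set H}) (I : finType)
    (S : I -> {set H}) (i0 : I) :
  tree_decomposition B -> (forall i, connected_in (S i)) ->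
  (forall i j, exists x, (x \in S i) && (x \in S j)) ->
  exists t, forall i, exists2 x, x \in S i & x \in B t.
Proof.
move=> [Ttree Bvertex Bedge Bconn] Sconn meet.
pose U i : {set T} := [set t | [exists x in S i, x \in B t]]%SET.
have UP i t : reflect (exists2 x, x \in S i & x \in B t) (t \in U i).
  by rewrite inE; apply: (iffP exists_inP).
have [||t tU] := tree_helly (S := U) i0 Ttree.
- move=> i a b /UP[x xS xa] /UP[y yS yb].
  have bags z s t : z \in S i -> z \in B s -> z \in B t -> connect (induced_adj (U i)) s t.
    move=> zS zs zt; apply: connect_sub (Bconn z s t zs zt) => c d /= /and3P[cd zc zd].
    by apply: connect1; rewrite /induced_adj /= cd /=; apply/andP; split; apply/UP; exists z.
  have base t : x \in B t -> connect (induced_adj (U i)) a t by exact: bags.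
  apply: (connect_ind (P := fun z => forall t, z \in B t ->
    connect (induced_adj (U i)) a t) _ (Sconn i x y xS yS) base) => //.
  move=> u v /and3P[uv uS vS] IH t vt; have [s /andP[us vs]] := Bedge u v uv.
  exact: connect_trans (IH s us) (bags v s t vS vs vt).
- move=> i j; have [x /andP[xi xj]] := meet i j; have [t xt] := Bvertex x.
  by exists t; apply/andP; split; apply/UP; exists x.
- by exists t => i; apply/UP.
Qed.

Lemma treewidth_ge (H : sgraph) (k : nat) :
  (forall (T : sgraph) (B : T -> {set H}), tree_decomposition B ->
     exists t, (k < #|B t|)%N) ->
  (k <= treewidth H)%N.
Proof.
move=> bag; rewrite /treewidth; case: ex_minnP => m /asboolP[T [B [dec <-]]] _.
have [t kt] := bag T B dec; rewrite /width.
have := leq_bigmax (F := fun t => #|B t|) t; lia.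
Qed.

(** This serves to absorb the additive constant that separates bag size from width. *)
Lemma treewidth_gt0 (H : sgraph) (x y : H) : adj x y -> (0 < treewidth H)%N.
Proof.
move=> xy; apply: treewidth_ge => T B [_ _ Bedge _].
have [t /andP[xt yt]] := Bedge x y xy; exists t.
have nxy : x != y by apply: contraTneq xy => ->; rewrite adj_irrefl.
have := subset_leq_card (A := [set x; y]%SET) (B := B t); rewrite cards2 nxy; apply.
by apply/fintype.subsetP => z; rewrite !inE => /orP[] /eqP ->.
Qed.

(** * Walks and weighted distances *)

Lemma path_weight_cat (R : realType) (H : sgraph) (w : H -> H -> R) (x : H) p q :
  path_weight w x (p ++ q) = path_weight w x p + path_weight w (last x p) q.
Proof.
by rewrite /path_weight pairmap_cat big_cat.
Qed.

Lemma path_weight_cons (R : realType) (H : sgraph) (w : H -> H -> R) (x y : H) p :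
  path_weight w x (y :: p) = w x y + path_weight w y p.
Proof. by rewrite /path_weight /= big_cons. Qed.

Lemma path_weight_unit (R : realType) (H : sgraph) (x : H) p :
  path_weight (@unit_weight R H) x p = (size p)%:R.
Proof.
elim: p x => [|y p IHp] x; first by rewrite /path_weight big_nil.
by rewrite path_weight_cons IHp /unit_weight -natr1 addrC.
Qed.

Lemma edge_weighting_unit (R : realType) (H : sgraph) :
  edge_weighting (@unit_weight R H).
Proof. by move=> x y _; rewrite /unit_weight ler01. Qed.

Lemma path_weight_ge0 (R : realType) (H : sgraph) (w : H -> H -> R) (x : H) p :
  edge_weighting w -> path (@adj H) x p -> 0 <= path_weight w x p.
Proof.
move=> ew; elim: p x => [|y p IHp] x /=; first by rewrite /path_weight big_nil.
move=> /andP[xy yp]; rewrite path_weight_cons addr_ge0 ?IHp //.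
by have [] := ew x y xy.
Qed.

Lemma rev_walk (R : realType) (H : sgraph) (w : H -> H -> R) (x : H) p :
  edge_weighting w -> path (@adj H) x p ->
  exists q, [/\ path (@adj H) (last x p) q, last (last x p) q = x &
    path_weight w (last x p) q = path_weight w x p].
Proof.
move=> ew; elim: p x => [|y p IHp] x /=; first by exists nil.
move=> /andP[xy /IHp[q [qp ql qw]]]; exists (rcons q x).
rewrite rcons_path qp ql last_rcons adj_sym xy; split=> //.
rewrite -cats1 path_weight_cat ql qw !path_weight_cons /path_weight !big_nil addr0 addrC.
by have [_ ->] := ew x y xy.
Qed.

(** [wdist] is an infimum over simple paths, whereas concatenation only yields walks. If [x] recurs
    on the simple path found from [y], keeping only the part after that occurrence does not increase
    the weight, since weights are nonnegative. *)
Lemma shorten_walk (R : realType) (H : sgraph) (w : H -> H -> R) (x : H) p :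
  edge_weighting w -> path (@adj H) x p ->
  exists2 q, path_from_to x (last x p) q & path_weight w x q <= path_weight w x p.
Proof.
move=> ew; elim: p x => [|y p IHp] x /=; first by exists nil.
move=> /andP[xy /IHp[q [qp qu ql] qw]]; have [w0 _] := ew x y xy.
rewrite path_weight_cons.
have [xq|xq] := boolP (x \in y :: q); last first.
  by exists (y :: q); [split; rewrite /= ?xy ?xq | rewrite path_weight_cons lerD2l].
case/splitPl: xq qp qu ql qw => p1 p2 p1x; rewrite cat_path -cat_cons cat_uniq.
rewrite last_cat path_weight_cat p1x => /andP[p1p p2p] /and3P[_ p12 p2u] p2l qw.
exists p2; first split=> //=.
  rewrite p2u andbT; apply: contra p12 => xp2; apply/hasP; exists x => //=.
  by rewrite -p1x mem_last.
by have := path_weight_ge0 ew p1p; lra.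
Qed.

Lemma wdist_le_walk (R : realType) (H : sgraph) (w : H -> H -> R) (x : H) p :
  edge_weighting w -> path (@adj H) x p ->
  (wdist w x (last x p) <= (path_weight w x p)%:E)%E.
Proof.
move=> ew xp; have [q qP qw] := shorten_walk ew xp.
apply: le_trans (ereal_inf_lbound _) _; first by exists q.
by rewrite lee_fin.
Qed.

Lemma wdist_lt_walk (R : realType) (H : sgraph) (w : H -> H -> R) (x y : H) (r : R) :
  (wdist w x y < r%:E)%E ->
  exists p, [/\ path (@adj H) x p, last x p = y & path_weight w x p < r].
Proof. by move=> /ereal_inf_lt[_ [p [pp _ pl] <-]]; rewrite lte_fin; exists p. Qed.

Lemma walk_connect (H : sgraph) (S : {set H}) (x : H) p :
  path (@adj H) x p -> {subset x :: p <= S} -> connect (induced_adj S) x (last x p).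
Proof.
elim: p x => [|y p IHp] x /=; first by rewrite connect0.
move=> /andP[xy yp] pS; apply: (connect_trans (y := y)).
  by apply: connect1; rewrite /induced_adj /= xy !pS ?inE ?eqxx ?orbT.
by apply: IHp => // z zp; apply: pS; rewrite inE zp orbT.
Qed.

(** * Balls and thickened sets *)

(** The ball is defined by walks so that, with nonnegative weights, each prefix of a witnessing walk
    is itself a witness for its end; this makes balls connected. *)
Definition walk_ball (R : realType) (H : sgraph) (w : H -> H -> R) (c : H) (r : R) :
    {set H} :=
  [set x | `[< exists p, [/\ path (@adj H) c p, last c p = x &
                             path_weight w c p < r] >]]%SET.

Lemma walk_ballP (R : realType) (H : sgraph) (w : H -> H -> R) (c : H) (r : R) x :
  reflect (exists p, [/\ path (@adj H) c p, last c p = x & path_weight w c p < r])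
    (x \in walk_ball w c r).
Proof. by rewrite inE; exact: asboolP. Qed.

Lemma walk_ball_center (R : realType) (H : sgraph) (w : H -> H -> R) (c : H) (r : R) :
  0 < r -> c \in walk_ball w c r.
Proof. by move=> r0; apply/walk_ballP; exists nil; rewrite /path_weight big_nil. Qed.

Lemma walk_ball_connect (R : realType) (H : sgraph) (w : H -> H -> R) (c : H) (r : R)
    (S : {set H}) (x : H) :
  edge_weighting w -> {subset walk_ball w c r <= S} -> x \in walk_ball w c r ->
  connect (induced_adj S) c x.
Proof.
move=> ew bS /walk_ballP[p [pp <- pr]]; apply: walk_connect => // z zp.
apply/bS/walk_ballP; case/splitPl: zp pp pr => p1 p2 p1z.
rewrite cat_path path_weight_cat => /andP[p1p p2p] pr; exists p1; split=> //.
by have := path_weight_ge0 ew p2p; lra.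
Qed.

Lemma walk_ball_meet (R : realType) (H : sgraph) (w : H -> H -> R) (a b x : H) (r : R) :
  edge_weighting w -> x \in walk_ball w a r -> x \in walk_ball w b r ->
  (wdist w a b < (2 * r)%:E)%E.
Proof.
move=> ew /walk_ballP[p [pp px pr]] /walk_ballP[q [qp qx qr]].
have [q' [q'p q'l q'w]] := rev_walk ew qp.
rewrite qx -px in q'p q'l q'w.
have := @wdist_le_walk _ _ w a (p ++ q') ew.
rewrite cat_path pp q'p last_cat q'l path_weight_cat q'w => /(_ isT) le.
by apply: le_lt_trans le _; rewrite lte_fin; lra.
Qed.

Definition thicken (R : realType) (G H : sgraph) (w : H -> H -> R) (f : G -> H)
    (r : R) (U : {set G}) : {set H} :=
  [set x | [exists v in U, x \in walk_ball w (f v) r]]%SET.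

Lemma thickenP (R : realType) (G H : sgraph) (w : H -> H -> R) (f : G -> H)
    (r : R) (U : {set G}) (x : H) :
  reflect (exists2 v, v \in U & x \in walk_ball w (f v) r) (x \in thicken w f r U).
Proof. by rewrite inE; apply: (iffP exists_inP). Qed.

(* A walk of weight less than [2r] stays within [r] of its ends. *)
Lemma thicken_connected (R : realType) (G H : sgraph) (w : H -> H -> R) (f : G -> H)
    (r : R) (U : {set G}) :
  edge_weighting w ->
  (forall u v, adj u v -> (wdist w (f u) (f v) < (2 * r)%:E)%E) ->
  connected_in U -> connected_in (thicken w f r U).
Proof.
move=> ew short Uconn x y /thickenP[u uU xu] /thickenP[v vU yv].
have ball v' z : v' \in U -> z \in walk_ball w (f v') r ->
    connect (induced_adj (thicken w f r U)) (f v') z.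
  move=> v'U; apply: walk_ball_connect => // t tb.
  by apply/thickenP; exists v'.
rewrite (connect_trans (y := f u)) ?(connect_trans _ (ball v y vU yv)) //.
  by rewrite induced_connect_sym ball.
apply: (connect_ind (P := fun v => connect _ (f u) (f v)) _ (Uconn u v uU vU)) => //.
move=> {x y v vU xu yv} a b /and3P[ab aU bU] /connect_trans; apply.
have [p [pp pl pw]] := wdist_lt_walk (short a b ab).
rewrite -pl; apply: walk_connect => // z zp; apply/thickenP.
case/splitPl: zp pp pl pw => p1 p2 p1z.
rewrite cat_path last_cat path_weight_cat p1z => /andP[p1p p2p] p2b pw.
have [p1r|p1r] := ltP (path_weight w (f a) p1) r.
  by exists a => //; apply/walk_ballP; exists p1.
have [q [qp ql qw]] := rev_walk ew p2p; rewrite p2b in qp ql qw.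
exists b => //; apply/walk_ballP; exists q; split=> //; rewrite qw; lra.
Qed.

(** * Straight-line drawings and planarity of the grid with leaves *)

Definition segment_pt (R : realType) (a b : R * R) (t : R) : R * R :=
  (a.1 + t * (b.1 - a.1), a.2 + t * (b.2 - a.2)).

Definition segment (R : realType) (a b : R * R) : set (R * R) :=
  segment_pt a b @` `[0, 1].

Lemma segmentC (R : realType) (a b : R * R) : segment a b = segment b a.
Proof.
suff sub (c d : R * R) : segment c d `<=` segment d c by apply/seteqP; split; exact: sub.
move=> q [t /=]; rewrite in_itv /= => /andP[t0 t1] <-; exists (1 - t).
  by rewrite /= in_itv /=; apply/andP; split; lra.
by rewrite /segment_pt; congr pair; ring.
Qed.

Lemma segment_left (R : realType) (a b : R * R) : segment a b a.
Proof.
exists 0; first by rewrite /= in_itv /= lexx ler01.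
by rewrite /segment_pt !mul0r !addr0 -surjective_pairing.
Qed.

Lemma segment_arc (R : realType) (a b : R * R) : a <> b -> is_arc (segment a b) a b.
Proof.
move=> ab; exists (segment_pt a b); split=> //.
- apply: continuous_subspaceT => t.
  apply: (@cvg_pair _ _ _ _ (nbhs (a.1 + t * (b.1 - a.1))) (nbhs (a.2 + t * (b.2 - a.2)))).
    by apply: cvgD; [exact: cvg_cst | apply: cvgM; [exact: cvg_id | exact: cvg_cst]].
  by apply: cvgD; [exact: cvg_cst | apply: cvgM; [exact: cvg_id | exact: cvg_cst]].
- move=> s t _ _ [] /addrI e1 /addrI e2; apply/eqP/negPn/negP => st.
  have diff c d : s * (d - c) = t * (d - c) -> c = d.
    move=> /eqP; rewrite -subr_eq0 -mulrBl mulf_eq0 !subr_eq0 (negPf st) /=.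
    by move=> /eqP.
  by apply: ab; rewrite [a]surjective_pairing [b]surjective_pairing (diff _ _ e1) (diff _ _ e2).
- by rewrite /segment_pt !mul0r !addr0 -surjective_pairing.
- by rewrite /segment_pt !mul1r ![_ + (_ - _)]addrC !subrK -surjective_pairing.
Qed.

(** Since no vertex is isolated, each vertex is an end of some segment, so a vertex in the interior
    of another segment already counts as a crossing of two segments. *)
Lemma straight_line_planar (R : realType) (G : sgraph) (pt : G -> R * R) :
  injective pt -> (forall x : G, exists y, adj x y) ->
  (forall (x y z t : G) q, adj x y -> adj z t ->
     segment (pt x) (pt y) q -> segment (pt z) (pt t) q ->
     q <> pt x -> q <> pt y -> [set z; t]%SET = [set x; y]%SET) ->
  planar R G.
Proof.
move=> pt_inj nbr cross; exists pt, (fun x y => segment (pt x) (pt y)).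
split=> // x y xy; split.
- by apply: segment_arc => /pt_inj xE; rewrite xE adj_irrefl in xy.
- exact: segmentC.
move=> q qxy qx qy; split=> [z qz|z t zt /eqP ne qzt]; last first.
  by apply: ne; exact: cross qxy qzt qx qy.
have [t zt] := nbr z.
have zxy : [set z; t]%SET = [set x; y]%SET.
  by apply: (cross x y z t q) => //; rewrite qz; exact: segment_left.
have : z \in [set x; y]%SET by rewrite -zxy !inE eqxx.
by rewrite !inE => /orP[] /eqP zE; [apply: qx | apply: qy]; rewrite qz zE.
Qed.

(* Arcs of the k x k grid, whose vertices are the [inl (i, j)], and of the star
   joining (0,0) to the leaves [inr l]; one orientation of each edge. *)
Definition tailed_grid_arc (k m : nat) : rel ('I_k * 'I_k + 'I_m) :=
  fun x y => match x, y with
  | inl p, inl q =>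
      (q.1 == p.1.+1 :> nat) && (q.2 == p.2 :> nat) ||
      (q.1 == p.1 :> nat) && (q.2 == p.2.+1 :> nat)
  | inl p, inr _ => (p.1 == 0 :> nat) && (p.2 == 0 :> nat)
  | inr _, _ => false
  end.

Lemma tailed_grid_sym (k m : nat) :
  symmetric (fun x y => @tailed_grid_arc k m x y || tailed_grid_arc y x).
Proof. by move=> x y; rewrite orbC. Qed.

Lemma tailed_grid_irrefl (k m : nat) :
  irreflexive (fun x y => @tailed_grid_arc k m x y || tailed_grid_arc y x).
Proof. by move=> [[i j]|l] //=; rewrite orbb; apply/negbTE; lia. Qed.

Definition tailed_grid (k m : nat) : sgraph :=
  SGraph (@tailed_grid_sym k m) (@tailed_grid_irrefl k m).

(** The leaves stand on a vertical line to the left of the grid, so the star edges touch the grid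
    only at the point of (0,0). *)
Definition grid_pt (R : realType) (k m : nat) (x : tailed_grid k m) : R * R :=
  match x with
  | inl p => ((p.1 : nat)%:R, (p.2 : nat)%:R)
  | inr l => (-1, (l : nat)%:R)
  end.

Lemma grid_pt_inj (R : realType) (k m : nat) : injective (@grid_pt R k m).
Proof.
move=> [[i j]|l] [[i' j']|l'] //= [].
- by move=> /eqP; rewrite eqr_nat => /eqP/val_inj -> /eqP; rewrite eqr_nat => /eqP/val_inj ->.
- by move=> e _; exfalso; have := ler0n R i; lra.
- by move=> e _; exfalso; have := ler0n R i'; lra.
- by move=> /eqP; rewrite eqr_nat => /eqP/val_inj ->.
Qed.

(** This identifies collinear grid edges that share an interior point; with [t = 0] it shows that
    such a point has a noninteger coordinate along its edge. *)
Lemma natr_shift (R : realType) (i j : nat) (s t : R) :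
  0 < s -> s < 1 -> 0 <= t -> t <= 1 -> i%:R + s = j%:R + t -> i = j.
Proof.
move=> s0 s1 t0 t1 e; apply/eqP; rewrite eqn_leq.
by apply/andP; split; rewrite -ltnS -(ltr_nat R) -natr1; lra.
Qed.

(** An interior point of a grid edge has exactly one noninteger coordinate, which fixes the
    direction and then the position of any grid edge through it. Interior points of star edges have
    negative first coordinate, and two star edges with a common such point have the same slope. *)
Lemma tailed_grid_cross (R : realType) (k m : nat) (x y z t : tailed_grid k m) (q : R * R) :
  tailed_grid_arc x y -> tailed_grid_arc z t ->
  segment (grid_pt R x) (grid_pt R y) q -> segment (grid_pt R z) (grid_pt R t) q ->
  q <> grid_pt R x -> q <> grid_pt R y -> z = x /\ t = y.
Proof.
move=> xy zt [s] /= + <- [s'] /= + qE qx qy.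
rewrite !in_itv /= => /andP[s0 s1] /andP[s'0 s'1].
have {qx}s0 : 0 < s.
  rewrite lt_neqAle s0 andbT; apply/eqP => sE; apply: qx.
  by rewrite -sE /segment_pt !mul0r !addr0 -surjective_pairing.
have {qy}s1 : s < 1.
  rewrite lt_neqAle s1 andbT; apply/eqP => sE; apply: qy.
  by rewrite sE /segment_pt !mul1r ![_ + (_ - _)]addrC !subrK -surjective_pairing.
move: qE; rewrite /segment_pt => -[].
have noninteger (a b : nat) : a%:R + s <> b%:R :> R.
  move=> e; have ab : a = b by apply: (natr_shift s0 s1 (lexx 0)); rewrite ?addr0.
  by move: e; rewrite ab; lra.
case: x xy => [[i j]|//]; case: z zt => [[i' j']|//]; rewrite /tailed_grid_arc /=.
have i0 := ler0n R i; have i'0 := ler0n R i'; have j0 := ler0n R j.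
have inlE (a b c d : 'I_k) : a = c :> nat -> b = d :> nat ->
    inl (a, b) = inl (c, d) :> 'I_k * 'I_k + 'I_m.
  by move=> /val_inj -> /val_inj ->.
case: t => [[i1' j1']|l']; case: y => [[i1 j1]|l] /=.
- move=> /orP[] /andP[/eqP zt1 /eqP zt2] /orP[] /andP[/eqP xy1 /eqP xy2];
    rewrite ?zt1 ?zt2 ?xy1 ?xy2 -?natr1 => q1 q2.
  + have ii : (i' : nat) = i by apply/esym/(@natr_shift R i i' s s') => //; lra.
    have /eqP : (j' : nat)%:R = (j : nat)%:R :> R by lra.
    by rewrite eqr_nat => /eqP jj; split; apply: inlE; lia.
  + by case: (noninteger j j'); lra.
  + by case: (noninteger i i'); lra.
  + have jj : (j' : nat) = j by apply/esym/(@natr_shift R j j' s s') => //; lra.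
    have /eqP : (i' : nat)%:R = (i : nat)%:R :> R by lra.
    by rewrite eqr_nat => /eqP ii; split; apply: inlE; lia.
- move=> zt /andP[/eqP xy1 /eqP xy2]; rewrite xy1 xy2 => q1 _; exfalso.
  (* The first coordinate of [q] is [-s < 0] on the star edge, but a convex combination of
     nonnegative numbers on the grid edge. *)
  have : 0 <= s' * (i1' : nat)%:R by rewrite mulr_ge0 ?ler0n.
  have : 0 <= (1 - s') * (i' : nat)%:R by rewrite mulr_ge0 ?subr_ge0 ?ler0n.
  by move: q1; lra.
- move=> /andP[/eqP zt1 /eqP zt2] /orP[] /andP[/eqP xy1 /eqP xy2];
    rewrite zt1 zt2 ?xy1 ?xy2 -?natr1 => q1 q2; exfalso; first lra.
  (* On a vertical grid edge [q] has first coordinate at least 0, where the star edge has only the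
     point (0,0); but the second coordinate [j + s] is positive. *)
  have s'E : s' = 0 by lra.
  by move: q2; rewrite s'E; lra.
- move=> /andP[/eqP zt1 /eqP zt2] /andP[/eqP xy1 /eqP xy2].
  rewrite zt1 zt2 xy1 xy2 mulr0n !subr0 !add0r => q1 q2.
  have s'E : s' = s by lra.
  move: q2; rewrite s'E => /(mulfI (lt0r_neq0 s0))/eqP; rewrite eqr_nat => /eqP/val_inj ->.
  by split=> //; apply: inlE; rewrite ?zt1 ?zt2 ?xy1 ?xy2.
Qed.

Lemma tailed_grid_planar (R : realType) (k m : nat) :
  (1 < k)%N -> planar R (tailed_grid k m).
Proof.
move=> k1; apply: (straight_line_planar (@grid_pt_inj R k m)).
  case=> [[i j]|l].
    have [ik|ik] := ltnP i.+1 k.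
      by exists (inl (Ordinal ik, j)); rewrite /adj /= !eqxx.
    have ik' : (i.-1 < k)%N by have := ltn_ord i; lia.
    by exists (inl (Ordinal ik', j)); rewrite /adj /= !eqxx /=; lia.
  by exists (inl (Ordinal (ltnW k1), Ordinal (ltnW k1))); rewrite /adj /= !eqxx.
move=> x y z t q /orP[] xy /orP[] zt qxy qzt qx qy.
- by have [-> ->] := tailed_grid_cross xy zt qxy qzt qx qy.
- rewrite segmentC in qzt.
  by have [-> ->] := tailed_grid_cross xy zt qxy qzt qx qy; rewrite finset.setUC.
- rewrite segmentC in qxy.
  by have [-> ->] := tailed_grid_cross xy zt qxy qzt qy qx; rewrite finset.setUC.
- rewrite segmentC in qxy; rewrite segmentC in qzt.
  by have [-> ->] := tailed_grid_cross xy zt qxy qzt qy qx.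
Qed.

(** * Distances and walks in the grid *)

Lemma gdist_lipschitz (R : realType) (G : sgraph) (h : G -> nat) (x y : G) (n : nat) :
  (forall a b : G, adj a b -> (h a <= (h b).+1)%N) ->
  (gdist R x y < n%:R%:E)%E -> (h x < h y + n)%N.
Proof.
move=> lip /wdist_lt_walk[p [pp <- ]]; rewrite path_weight_unit ltr_nat => pn.
suff : (h x <= h (last x p) + size p)%N by lia.
elim: p x pp {pn} => [|a p IHp] x /=; first by rewrite addn0.
by move=> /andP[/lip xa /IHp]; lia.
Qed.

Lemma gdist_adj (R : realType) (G : sgraph) (x y : G) :
  adj x y -> (gdist R x y <= 1%:E)%E.
Proof.
move=> xy; have xyp : path (@adj G) x [:: y] by rewrite /= xy.
apply: le_trans (wdist_le_walk (@edge_weighting_unit R G) xyp) _.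
by rewrite path_weight_unit.
Qed.

(** The length bound serves for the diameter, the confinement to [U] for the connectedness of
    crosses. *)
Definition stays_within (G : sgraph) (U : {set G}) (n : nat) (x y : G) : Prop :=
  exists p, [/\ path (induced_adj U) x p, last x p = y & (size p <= n)%N].

Lemma stays_within_trans (G : sgraph) (U : {set G}) (n m : nat) (x y z : G) :
  stays_within U n x y -> stays_within U m y z -> stays_within U (n + m)%N x z.
Proof.
move=> [p [pp pl pn]] [q [qp ql qm]]; exists (p ++ q).
by rewrite cat_path last_cat size_cat pl pp qp ql leq_add.
Qed.

Lemma stays_within_sym (G : sgraph) (U : {set G}) (n : nat) (x y : G) :
  stays_within U n x y -> stays_within U n y x.
Proof.
move=> [p [pp <- pn]]; exists (rev (belast x p)); split.
- rewrite rev_path (eq_path (e' := induced_adj U)) // => a b.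
  by rewrite /induced_adj /= adj_sym [(a \in U) && _]andbC.
- by case: p {pp pn} => //= a p; rewrite rev_cons last_rcons.
- by rewrite size_rev size_belast.
Qed.

Lemma stays_within_leq (G : sgraph) (U : {set G}) (n m : nat) (x y : G) :
  (n <= m)%N -> stays_within U n x y -> stays_within U m x y.
Proof. by move=> nm [p [pp pl pn]]; exists p; split=> //; apply: leq_trans nm. Qed.

Lemma stays_within_connect (G : sgraph) (U : {set G}) (n : nat) (x y : G) :
  stays_within U n x y -> connect (induced_adj U) x y.
Proof. by move=> [p [pp pl _]]; apply/connectP; exists p. Qed.

Lemma gdist_le (R : realType) (G : sgraph) (U : {set G}) (n : nat) (x y : G) :
  stays_within U n x y -> (gdist R x y <= n%:R%:E)%E.
Proof.
move=> [p [pp <- pn]].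
have {}pp : path (@adj G) x p by apply: sub_path pp => a b /and3P[].
apply: le_trans (wdist_le_walk (@edge_weighting_unit R G) pp) _.
by rewrite path_weight_unit lee_fin ler_nat.
Qed.

(** Leaves receive the coordinate of their neighbour (0,0), which keeps both coordinates
    1-Lipschitz. *)
Definition grid_coord1 (k m : nat) (x : tailed_grid k m) : nat :=
  if x is inl p then p.1 else 0.

Definition grid_coord2 (k m : nat) (x : tailed_grid k m) : nat :=
  if x is inl p then p.2 else 0.

Lemma grid_coord1_lipschitz (k m : nat) (x y : tailed_grid k m) :
  adj x y -> (grid_coord1 x <= (grid_coord1 y).+1)%N.
Proof. by case: x y => [[i j]|l] [[i' j']|l']; rewrite /adj /=; lia. Qed.

Lemma grid_coord2_lipschitz (k m : nat) (x y : tailed_grid k m) :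
  adj x y -> (grid_coord2 x <= (grid_coord2 y).+1)%N.
Proof. by case: x y => [[i j]|l] [[i' j']|l']; rewrite /adj /=; lia. Qed.

Lemma grid_line1 (k m : nat) (U : {set tailed_grid k m}) (j i i' : 'I_k) :
  (forall i, inl (i, j) \in U) -> stays_within U k.-1 (inl (i, j)) (inl (i', j)).
Proof.
move=> jU; wlog ii' : i i' / (i <= i')%N.
  move=> wl; case: (leqP i i') => [|/ltnW] /wl //; exact: stays_within_sym.
suff H d : forall i' : 'I_k, (i' = i + d :> nat)%N ->
    stays_within U d (inl (i, j)) (inl (i', j)).
  by apply: stays_within_leq (H (i' - i)%N i' _); have := ltn_ord i'; lia.
elim: d => [|d IHd] {ii'}i' i'E.
  by exists nil; rewrite (_ : i' = i) //; apply: val_inj => /=; lia.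
have di : (i + d < k)%N by have := ltn_ord i'; lia.
rewrite -addn1; apply: stays_within_trans (IHd (Ordinal di) erefl) _.
exists [:: inl (i', j)]; split=> //=.
by rewrite /induced_adj /= !jU !andbT /adj /= eqxx; lia.
Qed.

Lemma grid_line2 (k m : nat) (U : {set tailed_grid k m}) (i j j' : 'I_k) :
  (forall j, inl (i, j) \in U) -> stays_within U k.-1 (inl (i, j)) (inl (i, j')).
Proof.
move=> iU; wlog jj' : j j' / (j <= j')%N.
  move=> wl; case: (leqP j j') => [|/ltnW] /wl //; exact: stays_within_sym.
suff H d : forall j' : 'I_k, (j' = j + d :> nat)%N ->
    stays_within U d (inl (i, j)) (inl (i, j')).
  by apply: stays_within_leq (H (j' - j)%N j' _); have := ltn_ord j'; lia.
elim: d => [|d IHd] {jj'}j' j'E.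
  by exists nil; rewrite (_ : j' = j) //; apply: val_inj => /=; lia.
have dj : (j + d < k)%N by have := ltn_ord j'; lia.
rewrite -addn1; apply: stays_within_trans (IHd (Ordinal dj) erefl) _.
exists [:: inl (i, j')]; split=> //=.
by rewrite /induced_adj /= !iU !andbT /adj /= eqxx; lia.
Qed.

(** One line in each direction costs [k.-1] edges, and each end that is a leaf costs one more. *)
Lemma tailed_grid_stays_within (k m : nat) (x y : tailed_grid k m) :
  (0 < k)%N -> stays_within [set: tailed_grid k m]%SET (k.-1 + k.-1 + 2)%N x y.
Proof.
move=> k0; pose o := Ordinal k0.
have grid (p q : 'I_k * 'I_k) :
    stays_within [set: tailed_grid k m]%SET (k.-1 + k.-1)%N (inl p) (inl q).
  case: p q => [i j] [i' j']; apply: (@stays_within_trans (tailed_grid k m) _ _ _ _ (inl (i', j))).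
    by apply: grid_line1 => ?; rewrite inE.
  by apply: grid_line2 => ?; rewrite inE.
have leaf (l : 'I_m) : stays_within [set: tailed_grid k m]%SET 1 (inr l) (inl (o, o)).
  by exists [:: inl (o, o)]; rewrite /induced_adj /adj /= !inE.
case: x y => [p|l] [q|l'].
- by apply: stays_within_leq (grid p q); lia.
- apply: stays_within_leq (stays_within_trans (grid p (o, o)) (stays_within_sym (leaf l'))).
  lia.
- by apply: stays_within_leq (stays_within_trans (leaf l) (grid (o, o) q)); lia.
- apply: stays_within_leq (stays_within_trans (leaf l) (stays_within_sym (leaf l'))).
  lia.
Qed.

(** * Crosses of the grid and the bags that meet them *)

Definition grid_cross (k m : nat) (c : 'I_k * 'I_k) : {set tailed_grid k m} :=
  [set x | if x is inl p then (p.1 == c.1) || (p.2 == c.2) else false]%SET.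

Lemma grid_cross_connected (k m : nat) (c : 'I_k * 'I_k) :
  connected_in (grid_cross m c).
Proof.
move=> a b aU bU.
suff center x : x \in grid_cross m c -> connect (induced_adj (grid_cross m c)) x (inl c).
  by apply: connect_trans (center a aU) _; rewrite induced_connect_sym center.
case: c x {a b aU bU} => i j [[i' j']|l]; rewrite inE //= => /orP[] /eqP ->.
  by apply: stays_within_connect (grid_line2 _ _ _) => ?; rewrite inE /= eqxx.
by apply: stays_within_connect (grid_line1 _ _ _) => ?; rewrite inE /= eqxx orbT.
Qed.

(* The levels [i] met by the balls containing a given [x] differ by at most 2, so
   they are determined by their residues modulo 3. *)
Lemma missed_level (R : realType) (G H : sgraph) (w : H -> H -> R) (f : G -> H)
    (h : G -> nat) (X : {set H}) (k : nat) :
  edge_weighting w ->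
  (forall u v, (wdist w (f u) (f v) < 3%:R%:E)%E -> (h u < h v + 3)%N) ->
  (3 * #|X| < k)%N ->
  exists i : 'I_k, forall x v,
    x \in X -> x \in walk_ball w (f v) (3 / 2) -> h v != i.
Proof.
move=> ew near Xk.
pose A x : {set 'I_k} :=
  [set i : 'I_k | [exists v, (h v == i) && (x \in walk_ball w (f v) (3 / 2))]]%SET.
have A3 x : (#|A x| <= 3)%N.
  pose r (i : 'I_k) : 'I_3 := inord (i %% 3).
  rewrite -(card_in_imset (f := r)); first by rewrite -[leqRHS]card_ord max_card.
  move=> i i'; rewrite !inE => /existsP[v /andP[/eqP vi vx]] /existsP[v' /andP[/eqP v'i v'x]].
  move=> /(congr1 val); rewrite /= !inordK ?ltn_pmod // => ii'; apply: val_inj => /=.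
  have vv' := walk_ball_meet ew vx v'x; have v'v := walk_ball_meet ew v'x vx.
  rewrite (_ : 2 * (3 / 2) = 3%:R) in vv' v'v; last by field.
  by move: (near _ _ vv') (near _ _ v'v); rewrite vi v'i; lia.
(* The sets [A x] for [x] in [X] cover at most [3 * #|X| < k] levels. *)
have [i _ iA] : exists2 i : 'I_k, i \in [set: 'I_k]%SET & i \notin (\bigcup_(x in X) A x)%SET.
  apply/subsetPn; apply/negP => /subset_leq_card; rewrite cardsT card_ord leqNgt => /negP; apply.
  apply: leq_ltn_trans Xk.
  rewrite mulnC -sum_nat_const; elim/big_ind2: _ => [|n Y p Z Yn Zp|x _] //.
    by rewrite cards0.
  by apply: leq_trans (leq_of_leqif (leq_card_setU _ _)) (leq_add Yn Zp).
exists i => x v xX xv; apply: contra iA => /eqP vi.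
by apply/bigcupP; exists x => //; rewrite inE; apply/existsP; exists v; rewrite vi eqxx.
Qed.

Lemma tailed_grid_bag (R : realType) (k m : nat) (H T : sgraph) (w : H -> H -> R)
    (f : tailed_grid k m -> H) (B : T -> {set H}) :
  edge_weighting w ->
  (forall u v, adj u v -> (wdist w (f u) (f v) < 3%:R%:E)%E) ->
  (forall u v, (gdist R u v <= wdist w (f u) (f v))%E) ->
  (0 < k)%N -> tree_decomposition B -> exists t, (k <= 3 * #|B t|)%N.
Proof.
move=> ew short dom k0 dec.
have three : 2 * (3 / 2) = 3%:R :> R by field.
pose S (c : 'I_k * 'I_k) := thicken w f (3 / 2) (grid_cross m c).
have [||t tS] := bramble_bag (S := S) (Ordinal k0, Ordinal k0) dec.
- move=> c; apply: thicken_connected (@grid_cross_connected _ _ _) => //.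
  by rewrite three.
(* The grid vertex (i, j') belongs to both crosses. *)
- move=> [i j] [i' j']; exists (f (inl (i, j'))); apply/andP.
  have center : f (inl (i, j')) \in walk_ball w (f (inl (i, j'))) (3 / 2 : R).
    by apply: walk_ball_center; lra.
  by split; apply/thickenP; exists (inl (i, j')); rewrite // inE /= eqxx ?orbT.
exists t; rewrite leqNgt; apply/negP => tk.
have near (h : tailed_grid k m -> nat) (lip : forall a b, adj a b -> (h a <= (h b).+1)%N) u v :
    (wdist w (f u) (f v) < 3%:R%:E)%E -> (h u < h v + 3)%N.
  by move=> uv; apply: (gdist_lipschitz lip (le_lt_trans (dom u v) uv)).
(* A bag that is too small misses a level [i] of the first coordinate and a level [j] of the second,
   hence the whole thickened cross centred at (i, j). *)
have [i iP] := missed_level ew (near _ (@grid_coord1_lipschitz k m)) tk.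
have [j jP] := missed_level ew (near _ (@grid_coord2_lipschitz k m)) tk.
have [x /thickenP[[[a b]|l] + xv] xt] := tS (i, j); rewrite inE //= => /orP[] /eqP vE.
  by have := iP x _ xt xv; rewrite /= vE eqxx.
by have := jP x _ xt xv; rewrite /= vE eqxx.
Qed.

(** * Choice of the grid size and of the constants *)

Theorem theorem4 (R : realType) :
  exists C c : R, 0 < C /\ 0 < c /\
  forall (eps : R) (n : nat), 0 < eps -> eps < 1 / 2 ->
  C / eps ^+ 2 <= n%:R ->
  exists G : sgraph,
    #|G| = n /\ planar R G /\
    (diameter R G <= (1 / eps + 2)%:E)%E /\
    forall (H : sgraph) (w : H -> H -> R) (f : G -> H),
      edge_weighting w ->
      (forall u v : G,
         (gdist R u v <= wdist w (f u) (f v))%E /\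
         (wdist w (f u) (f v) <= gdist R u v + eps%:E * diameter R G)%E) ->
      c / eps <= (treewidth H)%:R.
Proof.
(* The factor 12 is 2 from [1 / eps < 2 * k] times 6 from the final bound of [k] by six times the
   treewidth. *)
exists 1, (12%:R^-1); split=> //; split=> // eps n eps0 eps2 nC.
have e2 : 2 < 1 / eps by rewrite ltr_pdivlMr //; lra.
(* Here [k] is the integer part of [1 / (2 * eps)] plus one. The lower estimate of [1 / eps] bounds
   the diameter, the upper one yields the treewidth. *)
have [k [k1 kle klt]] : exists k, [/\ (1 < k)%N, 2 * k.-1%:R <= 1 / eps & 1 / eps < 2 * k%:R :> R].
  have := truncn_itv (x := 1 / eps / 2).
  set q := Num.truncn _ => /(_ _)/andP[|lo hi]; first by lra.
  exists q.+1; split=> /=; [|lra|lra].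
  by rewrite ltnS lt0n; apply: contraTneq hi => ->; rewrite -leNgt; lra.
(* As [1 / eps > 2], [k] is at most [1 / (2 * eps) + 1 <= 1 / eps]; hence [C = 1] suffices. *)
have kn : (k * k <= n)%N.
  rewrite -(ler_nat R) natrM; apply: le_trans nC.
  have -> : 1 / eps ^+ 2 = (1 / eps) * (1 / eps) by field; lra.
  have k1R : k%:R = k.-1%:R + 1 :> R by rewrite natr1 prednK //; lia.
  by apply: ler_pM; rewrite ?ler0n //; lra.
exists (tailed_grid k (n - k * k)).
have diam : (diameter R (tailed_grid k (n - k * k)) <= (1 / eps + 2)%:E)%E.
  apply: ge_ereal_sup => _ [x [y ->]].
  apply: le_trans (gdist_le R (tailed_grid_stays_within x y (ltnW k1))) _.
  by rewrite lee_fin !natrD; lra.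
split; first by rewrite card_sum card_prod !card_ord subnKC.
split; first exact: tailed_grid_planar.
split=> // H w f ew df.
have short u v : adj u v -> (wdist w (f u) (f v) < 3%:R%:E)%E.
  move=> uv; have [_ /le_lt_trans] := df u v; apply.
  have uv1 : (gdist R u v <= 1%:E)%E.
    exact: gdist_adj.
  have add : (eps%:E * diameter R (tailed_grid k (n - k * k)) <= (1 + 2 * eps)%:E)%E.
    rewrite (_ : 1 + 2 * eps = eps * (1 / eps + 2)); last by field; lra.
    by rewrite EFinM lee_pmul2l ?lte_fin.
  by apply: le_lt_trans (leeD uv1 add) _; rewrite -EFinD lte_fin; lra.
have dom u v : (gdist R u v <= wdist w (f u) (f v))%E by have [] := df u v.
(* A walk of [H] joins the images of two adjacent vertices. If it is empty, the images coincide,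
   against domination; otherwise [H] has an edge. *)
have tw0 : (0 < treewidth H)%N.
  pose o : tailed_grid k (n - k * k) := inl (Ordinal (ltnW k1), Ordinal (ltnW k1)).
  pose o' : tailed_grid k (n - k * k) := inl (Ordinal k1, Ordinal (ltnW k1)).
  have oo' : adj o' o by rewrite /adj /=.
  have [[|a p] [/= pp pl _]] := wdist_lt_walk (short _ _ oo'); last first.
    by case/andP: pp => /treewidth_gt0.
  have : (gdist R o' o < 1%:R%:E)%E.
    apply: le_lt_trans (dom o' o) _; rewrite -pl.
    apply: le_lt_trans (@wdist_le_walk _ _ w (f o') [::] ew isT) _.
    by rewrite /path_weight big_nil lte_fin.
  by move/(gdist_lipschitz (@grid_coord1_lipschitz _ _)).
have tw : (k <= 3 * (treewidth H).+1)%N.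
  (* [k.-1 %/ 3] is [k / 3] rounded up, minus one: the width forced by a bag of at least [k / 3]
     vertices. *)
  have H1 : (k.-1 %/ 3 <= treewidth H)%N.
    apply: treewidth_ge => T B dec.
    by have [t kt] := tailed_grid_bag ew short dom (ltnW k1) dec; exists t; lia.
  lia.
(* For a positive treewidth [t], [3 * (t + 1) <= 6 * t]. *)
have : k%:R <= 6 * (treewidth H)%:R :> R by rewrite -natrM ler_nat; lia.
by move=> k6; rewrite -[_ / eps]mulrC; lra.
Qed.
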